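(* Let $F$ be a field of characteristic not $2$ or $3$ and $k\in F^*$. There is a bijection between $H^1(G_F,E_{-27k}[\hat\phi])$ and the set of ${\rm SL}_2(F)$-orbits on $V(F)_{4k}$. Moreover, the stabilizer in ${\rm SL}_2(F)$ of any $f\in V(F)_{4k}$ is isomorphic to $E_{-27k}[\hat\phi](F)$.
   Context: $E_k\colon y^2=x^3+k$; $\hat\phi\colon E_{-27k}\to E_k$ is the $3$-isogeny $(x,y)\mapsto\left(\frac{x^3-108k}{9x^2},\frac{y(x^3+216k)}{27x^3}\right)$. $V(F)$ is the space of binary cubic forms $f=[a,3b,3c,d]=au^3+3bu^2v+3cuv^2+dv^3$, $a,b,c,d\in F$, with ${\rm SL}_2(F)$ acting by linear change of variables; ${\rm disc}(f)=a^2d^2-6abcd+4ac^3+4b^3d-3b^2c^2$ and $V(F)_{4k}=\{f:{\rm disc}(f)=4k\}$. *)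

(* Defs.v *)
From HB Require Import structures.
From mathcomp Require Import all_boot all_order all_algebra all_field.
From mathcomp Require Import boolp classical_sets functions.
From mathcomp Require Import ring.

Set Implicit Arguments.
Unset Strict Implicit.
Unset Printing Implicit Defensive.

Import GRing.Theory.
Local Open Scope classical_set_scope.
Local Open Scope ring_scope.

Definition separable_closure (F Fs : fieldType) (iota : {rmorphism F -> Fs}) :
    Prop :=
  (forall x : Fs, exists p : {poly F},
     [/\ irreducible_poly p, separable_poly p & root (map_poly iota p) x]) /\
  (forall q : {poly Fs},
     separable_poly q -> (1 < size q)%N -> exists x : Fs, root q x).

Section AbsoluteGaloisGroup.
Variables (F Fs : fieldType) (iota : {rmorphism F -> Fs}).

Record absGal := AbsGal {
  gal_fun :> {rmorphism Fs -> Fs};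
  gal_bij : bijective gal_fun;
  gal_fix : forall x : F, gal_fun (iota x) = iota x }.

Lemma gal_eq (s t : absGal) : s =1 t -> s = t.
Proof.
case: s t => [s sb sf] [t tb tf] /= /funext st.
have e : s = t.
  case: s t {sb sf tb tf} st => [s [[sa] [sm]]] [t [[ta] [tm]]] /= st.
  by subst t; rewrite (Prop_irrelevance ta sa) (Prop_irrelevance tm sm).
by subst t; rewrite (Prop_irrelevance tb sb) (Prop_irrelevance tf sf).
Qed.

Definition gal_one : absGal :=
  @AbsGal idfun (inv_bij (fun=> erefl)) (fun=> erefl).

Lemma gal_mul_fix (s t : absGal) x : (s \o t) (iota x) = iota x.
Proof. by rewrite /= !gal_fix. Qed.

Definition gal_mul (s t : absGal) : absGal :=
  @AbsGal (s \o t) (bij_comp (gal_bij s) (gal_bij t)) (gal_mul_fix s t).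

Lemma gal_inv_ex (s : absGal) : exists t : absGal, cancel s t /\ cancel t s.
Proof.
have [g gK Kg] := gal_bij s.
pose ga := GRing.isZmodMorphism.Build _ _ g (can2_zmod_morphism gK Kg).
pose gm := GRing.isMonoidMorphism.Build _ _ g (can2_monoid_morphism gK Kg).
pose gr : {rmorphism Fs -> Fs} := HB.pack g ga gm.
have gb : bijective gr by exists s.
have gf x : gr (iota x) = iota x by rewrite -[in LHS](gal_fix s) /= gK.
by exists (AbsGal gb gf).
Qed.

Definition gal_inv (s : absGal) : absGal := sval (cid (gal_inv_ex s)).

HB.instance Definition _ := gen_eqMixin absGal.
HB.instance Definition _ := gen_choiceMixin absGal.

Fact gal_mulA : associative gal_mul.
Proof. by move=> s t u; apply: gal_eq. Qed.
Fact gal_mul1 : left_id gal_one gal_mul.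
Proof. by move=> s; apply: gal_eq. Qed.
Fact gal_mulr1 : right_id gal_one gal_mul.
Proof. by move=> s; apply: gal_eq. Qed.
Fact gal_mulV : left_inverse gal_one gal_inv gal_mul.
Proof.
move=> s; apply: gal_eq => x.
by rewrite /gal_inv; case: cid => t /= [st _]; apply: st.
Qed.
Fact gal_mulVr : right_inverse gal_one gal_inv gal_mul.
Proof.
move=> s; apply: gal_eq => x.
by rewrite /gal_inv; case: cid => t /= [_ ts]; apply: ts.
Qed.

HB.instance Definition _ :=
  isGroup.Build absGal gal_mulA gal_mul1 gal_mulr1 gal_mulV gal_mulVr.

(* Continuity for the Krull topology on G_F (a basis of neighbourhoods of s is
   given by the t agreeing with s on a finite subset of Fs) and the discrete
   topology on T. *)
Definition krull_continuous (T : Type) (c : absGal -> T) : Prop :=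
  forall s : absGal, exists X : seq Fs,
    forall t : absGal, {in X, t =1 s} -> c t = c s.

Section H1.
Variables (M : zmodType) (act : absGal -> M -> M).

Definition Z1 : set (absGal -> M) :=
  [set c | krull_continuous c /\
           forall s t : absGal, c (s * t)%g = c s + act s (c t)].

Definition B1 : set (absGal -> M) :=
  [set b | exists m : M, forall s : absGal, b s = act s m - m].

(* The quotient Z1 / B1, as the set of cosets of B1 in Z1. *)
Definition H1 : set (set (absGal -> M)) :=
  [set [set c \+ b | b in B1] | c in Z1].

End H1.
End AbsoluteGaloisGroup.

Section EllipticCurve.
Variable K : fieldType.

(* None is the point at infinity O, Some (x, y) an affine point. *)
Definition point := option (K * K).
HB.instance Definition _ := Choice.on point.

Definition on_curve (k : K) (P : point) : bool :=
  if P is Some (x, y) then y ^+ 2 == x ^+ 3 + k else true.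

Definition ec_opp (P : point) : point :=
  if P is Some (x, y) then Some (x, - y) else None.

(* Chord-and-tangent law on y^2 = x^3 + k, which does not involve k. *)
Definition ec_add (P Q : point) : point :=
  match P, Q with
  | None, _ => Q
  | _, None => P
  | Some (x1, y1), Some (x2, y2) =>
      if (x1 == x2) && (y1 == - y2) then None
      else
        let l := if x1 == x2 then (3 * x1 ^+ 2) / (2 * y1)
                 else (y2 - y1) / (x2 - x1) in
        let x3 := l ^+ 2 - x1 - x2 in
        Some (x3, l * (x1 - x3) - y1)
  end.

(* The isogeny E_{-27k} -> E_k; its affine formula has poles exactly at x = 0. *)
Definition hatphi (k : K) (P : point) : point :=
  if P is Some (x, y) then
    if x == 0 then None
    else Some ((x ^+ 3 - 108 * k) / (9 * x ^+ 2),
               y * (x ^+ 3 + 216 * k) / (27 * x ^+ 3))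
  else None.

Lemma on_curve_opp k P : on_curve k P -> on_curve k (ec_opp P).
Proof. by case: P => [[x y]|] //=; rewrite sqrrN. Qed.

Lemma on_curve_add k P Q :
  on_curve k P -> on_curve k Q -> on_curve k (ec_add P Q).
Proof.
case: P Q => [[x1 y1]|] [[x2 y2]|] //= /eqP h1 /eqP h2.
case: eqVneq => [e|ne] /=; last first.
  have d0 : x2 - x1 != 0 by rewrite subr_eq0 eq_sym.
  have -> : k = y1 ^+ 2 - x1 ^+ 3 by rewrite h1; ring.
  have h : y2 ^+ 2 - x2 ^+ 3 = y1 ^+ 2 - x1 ^+ 3 by rewrite h1 h2; ring.
  apply/eqP; set l := _ / _.
  have hl : y2 = y1 + l * (x2 - x1) by rewrite /l; field.
  move: h; rewrite hl => h.
  have {}h : l * (2 * y1 + l * (x2 - x1)) = x1 ^+ 2 + x1 * x2 + x2 ^+ 2.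
    apply: (mulfI d0); apply/eqP; rewrite -subr_eq0; apply/eqP.
    by move/eqP: h; rewrite -subr_eq0 => /eqP <-; ring.
  have h' : 2 * l * y1 = x1 ^+ 2 + x1 * x2 + x2 ^+ 2 - l ^+ 2 * (x2 - x1).
    by rewrite -h; ring.
  set x3 := _ - x2.
  apply/eqP; rewrite -subr_eq0; apply/eqP.
  transitivity ((x1 - x3) *
    (x1 ^+ 2 + x1 * x2 + x2 ^+ 2 - l ^+ 2 * (x2 - x1) - 2 * l * y1)).
    by rewrite /x3; ring.
  by rewrite h'; ring.
case: eqVneq => //= y12; subst x2.
have e2 : y1 ^+ 2 = y2 ^+ 2 by rewrite h1 h2.
have {e2} e : y1 = y2.
  by move/eqP: e2; rewrite eqf_sqr (negPf y12) orbF => /eqP.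
subst y2.
have d0 : 2 * y1 != 0 by rewrite mulr_natl mulr2n addr_eq0.
have -> : k = y1 ^+ 2 - x1 ^+ 3 by rewrite h1; ring.
set l := _ / _.
have hl : 2 * l * y1 = 3 * x1 ^+ 2.
  by rewrite mulrAC mulrC /l divfK.
set x3 := _ - x1.
rewrite -subr_eq0; apply/eqP.
transitivity ((x1 - x3) * (3 * x1 ^+ 2 - 2 * l * y1)); first by rewrite /x3; ring.
by rewrite hl; ring.
Qed.

Lemma on_curve_hatphi k P : 3%:R != 0 :> K ->
  on_curve (- 27 * k) P -> on_curve k (hatphi k P).
Proof.
move=> h3; case: P => [[x y]|] //= /eqP h.
case: eqVneq => //= x0; apply/eqP.
have h9 : 9%:R != 0 :> K by rewrite (natrM _ 3 3) mulf_neq0.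
have h27 : 27%:R != 0 :> K by rewrite (natrM _ 3 9) mulf_neq0.
rewrite !exprMn h; field.
by rewrite x0 h27 h9.
Qed.

(* E_{-27k}[hatphi](K) *)
Section Kernel.
Variable k : K.

Record kerphi := KerPhi {
  ker_point :> point;
  ker_pointP : on_curve (- 27 * k) ker_point && (hatphi k ker_point == None) }.

HB.instance Definition _ := [isSub for ker_point].
HB.instance Definition _ := [Choice of kerphi by <:].

Lemma kerphi_cases (P : kerphi) :
  ker_point P = None \/
  exists2 y, ker_point P = Some (0, y) & y ^+ 2 = - 27 * k.
Proof.
case: P => [[[x y]|] hP] /=; last by left.
case/andP: hP => /= /eqP hP; case: ifP => // /eqP x0 _; subst x.
by right; exists y => //; rewrite hP expr0n add0r.
Qed.

Lemma ec_add_x0 (y z : K) :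
  ec_add (Some (0, y)) (Some (0, z)) =
  if y == - z then None else Some (0, - y).
Proof.
rewrite /= eqxx /=; case: ifP => // _.
by rewrite expr0n /= mulr0 mul0r expr0n /= subrr subr0 mul0r sub0r.
Qed.

Fact ker_add_subproof (P Q : kerphi) :
  on_curve (- 27 * k) (ec_add P Q) && (hatphi k (ec_add P Q) == None).
Proof.
rewrite on_curve_add ?(proj1 (andP (ker_pointP _))) //=.
have [->|[y -> _]] := kerphi_cases P.
  by rewrite (proj2 (andP (ker_pointP Q))).
have [->|[z -> _]] := kerphi_cases Q; first by rewrite /= eqxx.
by rewrite ec_add_x0; case: ifP => //=; rewrite eqxx.
Qed.

Fact ker_opp_subproof (P : kerphi) :
  on_curve (- 27 * k) (ec_opp P) && (hatphi k (ec_opp P) == None).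
Proof.
rewrite on_curve_opp ?(proj1 (andP (ker_pointP _))) //=.
by have [->|[y -> _]] := kerphi_cases P; rewrite //= eqxx.
Qed.

Definition ker_zero : kerphi := @KerPhi None isT.
Definition ker_add (P Q : kerphi) := KerPhi (ker_add_subproof P Q).
Definition ker_opp (P : kerphi) := KerPhi (ker_opp_subproof P).

Fact ker_addC : commutative ker_add.
Proof.
move=> P Q; apply: val_inj => /=.
have [->|[y -> hy]] := kerphi_cases P; have [->|[z -> hz]] := kerphi_cases Q => //.
rewrite !ec_add_x0 [z == _]eq_sym eqr_oppLR; case: ifPn => // ne.
have /eqP : y ^+ 2 = z ^+ 2 by rewrite hy hz.
by rewrite eqf_sqr (negPf ne) orbF => /eqP ->.
Qed.

Fact ker_add0 : left_id ker_zero ker_add.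
Proof. by move=> P; apply: val_inj. Qed.

Fact ker_addN : left_inverse ker_zero ker_opp ker_add.
Proof.
move=> P; apply: val_inj => /=.
have [->|[y -> hy]] := kerphi_cases P => //.
by rewrite ec_add_x0 eqxx.
Qed.

Fact ker_addA : associative ker_add.
Proof.
move=> P Q R; apply: val_inj => /=.
have [->|[y -> hy]] := kerphi_cases P => //.
have [->|[z -> hz]] := kerphi_cases Q => //.
have [->|[w -> hw]] := kerphi_cases R; first by rewrite ec_add_x0; case: ifP.
have zE : (z == y) || (z == - y) by rewrite -eqf_sqr hz hy.
have wE : (w == y) || (w == - y) by rewrite -eqf_sqr hw hy.
have [e|ne] := eqVneq y (- y).
  move: zE wE; rewrite -!e !orbb => /eqP -> /eqP ->.
  by rewrite !ec_add_x0 -!e eqxx.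
have ne' : (- y == y) = false by rewrite eq_sym (negPf ne).
by case/orP: zE => /eqP ->; case/orP: wE => /eqP ->;
  rewrite !(ec_add_x0, opprK, eqxx, ne', negPf ne) //= ?(ec_add_x0, opprK, eqxx, ne', negPf ne).
Qed.

HB.instance Definition _ :=
  GRing.isZmodule.Build kerphi ker_addA ker_addC ker_add0 ker_addN.

End Kernel.
End EllipticCurve.

Section GaloisAction.
Variables (F Fs : fieldType) (iota : {rmorphism F -> Fs}) (k : F).

Definition gal_point (s : absGal iota) (P : point Fs) : point Fs :=
  if P is Some (x, y) then Some (s x, s y) else None.

Fact gal_ker_subproof (s : absGal iota) (P : kerphi (iota k)) :
  on_curve (- 27 * iota k) (gal_point s P) &&
  (hatphi (iota k) (gal_point s P) == None).
Proof.
have [->|[y -> hy]] := kerphi_cases P => //=.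
by rewrite rmorph0 eqxx andbT -rmorphXn hy rmorphM rmorphN rmorph_nat gal_fix
  expr0n add0r.
Qed.

Definition gal_ker (s : absGal iota) (P : kerphi (iota k)) :
  kerphi (iota k) := KerPhi (gal_ker_subproof s P).

Lemma gal_ker1 P : gal_ker 1%g P = P.
Proof. by apply: val_inj => /=; case: (ker_point P) => [[x y]|]. Qed.

Lemma gal_kerM s t P : gal_ker (s * t)%g P = gal_ker s (gal_ker t P).
Proof. by apply: val_inj => /=; case: (ker_point P) => [[x y]|]. Qed.

Lemma gal_kerD s : {morph gal_ker s : P Q / P + Q}.
Proof.
move=> P Q; apply: val_inj => /=.
have [->|[y -> hy]] := kerphi_cases P => //.
have [->|[z -> hz]] := kerphi_cases Q => //.
rewrite ec_add_x0 [gal_point s (Some (0, y))]/gal_point [gal_point s (Some (0, z))]/gal_point.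
rewrite !rmorph0 ec_add_x0 -!rmorphN (inj_eq (fmorph_inj s)).
by case: ifP => //= _; rewrite rmorph0.
Qed.

End GaloisAction.

Section BinaryCubicForms.
Variable R : comNzRingType.

(* Bcf a b c d is [a, 3b, 3c, d] = a u^3 + 3b u^2 v + 3c u v^2 + d v^3. *)
Record bcf := Bcf { bcf_a : R; bcf_b : R; bcf_c : R; bcf_d : R }.

Definition bcf_eval (f : bcf) (u v : R) : R :=
  let: Bcf a b c d := f in
  a * u ^+ 3 + 3 * b * u ^+ 2 * v + 3 * c * u * v ^+ 2 + d * v ^+ 3.

Definition disc (f : bcf) : R :=
  let: Bcf a b c d := f in
  a ^+ 2 * d ^+ 2 - 6 * a * b * c * d + 4 * a * c ^+ 3 + 4 * b ^+ 3 * d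
  - 3 * b ^+ 2 * c ^+ 2.

(* (g f)(u, v) = f((u, v) g), see bcf_eval_act. *)
Definition bcf_act (g : 'M[R]_2) (f : bcf) : bcf :=
  let: Bcf a b c d := f in
  let p := g 0 0 in let q := g 0 1 in let r := g 1 0 in let s := g 1 1 in
  Bcf (a * p ^+ 3 + 3 * b * p ^+ 2 * q + 3 * c * p * q ^+ 2 + d * q ^+ 3)
      (a * p ^+ 2 * r + b * (p ^+ 2 * s + 2 * p * q * r)
       + c * (q ^+ 2 * r + 2 * p * q * s) + d * q ^+ 2 * s)
      (a * p * r ^+ 2 + b * (q * r ^+ 2 + 2 * p * r * s)
       + c * (p * s ^+ 2 + 2 * q * r * s) + d * q * s ^+ 2)
      (a * r ^+ 3 + 3 * b * r ^+ 2 * s + 3 * c * r * s ^+ 2 + d * s ^+ 3).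

Lemma bcf_eval_act g f u v :
  bcf_eval (bcf_act g f) u v =
  bcf_eval f (u * g 0 0 + v * g 1 0) (u * g 0 1 + v * g 1 1).
Proof. by case: f => a b c d /=; ring. Qed.

Lemma bcf_act1 f : bcf_act 1%:M f = f.
Proof. by case: f => a b c d; rewrite /= !mxE /=; congr Bcf; ring. Qed.

Lemma bcf_actM g h f : bcf_act (g *m h) f = bcf_act g (bcf_act h f).
Proof.
case: f => a b c d; rewrite /= !mxE !big_ord_recl !big_ord0 /= !addr0.
rewrite (_ : lift ord0 ord0 = 1 :> 'I_2); last exact: val_inj.
by congr Bcf; ring.
Qed.

Lemma disc_act g f : disc (bcf_act g f) = (\det g) ^+ 6 * disc f.
Proof.
have -> : \det g = g 0 0 * g 1 1 - g 0 1 * g 1 0.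
  rewrite (expand_det_row _ 0) !big_ord_recl big_ord0 /cofactor !det_mx11 !mxE.
  rewrite /= (_ : lift 0 0 = 1 :> 'I_2); last exact: val_inj.
  rewrite (_ : lift 1 0 = 0 :> 'I_2); last exact: val_inj.
  by rewrite expr0 expr1; ring.
by case: f => a b c d /=; ring.
Qed.

Definition V_disc (m : R) : set bcf := [set f | disc f = m].

Definition SL2 : set 'M[R]_2 := [set g | \det g = 1].

Definition SL2_orbit (f : bcf) : set bcf := [set bcf_act g f | g in SL2].

Definition SL2_orbits (A : set bcf) : set (set bcf) :=
  [set SL2_orbit f | f in A].

Definition SL2_stab (f : bcf) : set 'M[R]_2 :=
  SL2 `&` [set g | bcf_act g f = f].

End BinaryCubicForms.

(* S is a multiplicative group of matrices. *)
Definition mx_group_iso (R : comNzRingType) (n : nat) (S : set 'M[R]_n)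
    (M : zmodType) : Prop :=
  exists h : 'M[R]_n -> M, set_bij S setT h /\
    forall g g' : 'M[R]_n, S g -> S g' -> h (g *m g') = h g + h g'.

(* Main.v *)
(* Over Fs all forms of discriminant 4k are SL2-equivalent to 3 u^2 v + k v^3,
   whose stabilizer consists of the matrices -1/2 + y [[0, 1/(6k)], [1/6, 0]]
   with y^2 = -27k, and the identity: it is E_{-27k}[hatphi] as a Galois
   module.  Hence a form f = g f0 over F gives the cocycle s |-> g^-1 s(g), and
   conversely a cocycle with values in the stabilizer is of this shape because
   H^1(F, SL2) is trivial (Hilbert 90 for GL2, then rescaling by the determinant,
   which is Galois invariant).  As the stabilizer is abelian, conjugation by g
   identifies the stabilizer of f over F with the rational points of the
   kernel.  Descent from Fs to F needs that F is the fixed field of G_F, which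
   is obtained by extending isomorphisms between subfields with Zorn's lemma. *)
From HB Require Import structures.
Require Import Defs.
From mathcomp Require Import all_boot all_order all_algebra all_field.
From mathcomp Require Import boolp classical_sets functions.
From mathcomp Require Import ring.

Set Implicit Arguments.
Unset Strict Implicit.
Unset Printing Implicit Defensive.

Import GRing.Theory.
Local Open Scope classical_set_scope.
Local Open Scope ring_scope.

(** * Extension of field isomorphisms *)

(* An isomorphism between subfields of K, given by its graph. *)
Record field_graph (K : fieldType) (S : set (K * K)) : Prop := FieldGraph {
  graph1 : S 1;
  graphB : forall z w, S z -> S w -> S (z - w);
  graphV : forall z w, S z -> S w -> S (z / w);
  graph_fun : forall z, S z -> (z.1 == 0) = (z.2 == 0) }.

Lemma irreducible_dichotomy (K : fieldType) (m : {poly K}) :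
  irreducible_poly m -> forall p, (m %| p) \/ exists u v, u * m + v * p = 1.
Proof.
move=> [m1 mirr] p.
have [/Bezout_eq1_coprimepP [[u v] /= e]|nc] := boolP (coprimep m p).
  by right; exists u, v.
by left; rewrite -(eqp_dvdl _ (mirr _ nc (dvdp_gcdl m p))) dvdp_gcdr.
Qed.

(** The image of K[X]. When [x] and [y] are roots of one irreducible polynomial, it is the graph of
    the isomorphism s(K)(x) -> t(K)(y). *)
Definition adjoin_graph (K L : fieldType) (s t : {rmorphism K -> L}) (x y : L) :
  set (L * L) := range (fun p => ((map_poly s p).[x], (map_poly t p).[y])).

Section Adjoin.
Context {K L : fieldType} {s t : {rmorphism K -> L}} {m : {poly K}} {x y : L}.
Hypotheses (mirr : irreducible_poly m).
Hypotheses (mx : root (map_poly s m) x) (my : root (map_poly t m) y).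

Lemma adjoin_graph_base a : adjoin_graph s t x y (s a, t a).
Proof. by exists a%:P => //; rewrite !map_polyC !hornerC. Qed.

Lemma adjoin_graph_gen : adjoin_graph s t x y (x, y).
Proof. by exists 'X => //; rewrite !map_polyX !hornerX. Qed.

(** Both evaluations K[X] -> L have kernel (m), so their joint image is a copy of the field
    K[X]/(m). Inverses come from the Bézout relation u m + v q = 1. *)
Lemma adjoin_field_graph : field_graph (adjoin_graph s t x y).
Proof.
have dvd0 p : m %| p -> (map_poly s p).[x] = 0 /\ (map_poly t p).[y] = 0.
  by move=> /dvdpP [q ->]; rewrite !rmorphM !hornerM (rootP mx) (rootP my) !mulr0.
split.
- by have := adjoin_graph_base 1; rewrite !rmorph1.
- by move=> _ _ [p _ <-] [q _ <-]; exists (p - q); rewrite // !rmorphB !hornerD !hornerN.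
- move=> _ _ [p _ <-] [q _ <-].
  have [/dvd0 [-> ->]|[u [v e]]] := irreducible_dichotomy mirr q.
    (* A non-unit is its own inverse by convention, so dividing by (0, 0) gives 0. *)
    exists 0; rewrite // !rmorph0 !horner0;
      rewrite (_ : (0, 0) = 0) // invr_out ?mulr0 //.
    by rewrite unitr0.
  have ex := congr1 (fun r => (map_poly s r).[x]) e.
  have ey := congr1 (fun r => (map_poly t r).[y]) e.
  rewrite rmorphD !rmorphM rmorph1 !hornerE (rootP mx) mulr0 add0r mulrC in ex.
  rewrite rmorphD !rmorphM rmorph1 !hornerE (rootP my) mulr0 add0r mulrC in ey.
  set w := ((map_poly s q).[x], (map_poly t q).[y]).
  rewrite (_ : w^-1 = ((map_poly s v).[x], (map_poly t v).[y])); last first.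
    by apply: mulr1_eq; congr (_, _).
  by exists (p * v); rewrite // !rmorphM !hornerM.
- move=> _ [p _ <-] /=.
  have [/dvd0 [-> ->]|[u [v e]]] := irreducible_dichotomy mirr p; first by rewrite !eqxx.
  have nz (r : {rmorphism K -> L}) z : root (map_poly r m) z -> (map_poly r p).[z] != 0.
    move=> /rootP rz; apply/eqP => pz;
      have /eqP := congr1 (fun q => (map_poly r q).[z]) e.
    by rewrite rmorphD !rmorphM rmorph1 !hornerE rz pz !mulr0 addr0 eq_sym oner_eq0.
  by rewrite !(negPf (nz _ _ _)).
Qed.
End Adjoin.

(** Induction on the size: a proper factorisation of [q] passes the root [x] to a factor of smaller
    size. *)
Lemma irreducible_root (K L : fieldType) (s : {rmorphism K -> L}) (q : {poly K}) x :
  q != 0 -> root (map_poly s q) x ->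
  exists2 m, irreducible_poly m & root (map_poly s m) x.
Proof.
have [n] := ubnP (size q); elim: n q => // n IHn q /ltnSE sq q0 qx.
have q1 : (1 < size q)%N.
  rewrite ltnNge; apply/negP => /size1_polyC e; move: q0 qx; rewrite e map_polyC rootC.
  by rewrite polyC_eq0 fmorph_eq0 => /negPf ->.
have [|nirr] := pselect (irreducible_poly q); first by exists q.
have [d [d1 /dvdpP [e qE] nd]] : exists d : {poly K},
    [/\ size d != 1%N, d %| q & ~~ (d %= q)].
  apply: contrapT => H; apply: nirr; split=> // d d1 dq.
  by apply: contrapT => /negP nd; apply: H; exists d.
have [e0 d0] : e != 0 /\ d != 0 by apply/andP; rewrite -negb_or -mulf_eq0 -qE.
have sE : size q = (size e + size d).-1 by rewrite qE size_mul.
have se : (1 < size e)%N.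
  rewrite ltn_neqAle size_poly_gt0 e0 andbT eq_sym; apply/negP => /eqP e1.
  move/negP: nd; apply; rewrite -dvdp_size_eqp ?qE ?dvdp_mull //.
  by rewrite -qE sE e1.
have sd : (1 < size d)%N by rewrite ltn_neqAle eq_sym d1 size_poly_gt0.
move: qx; rewrite qE rmorphM rootM => /orP [] /IHn; apply=> //.
  by apply: leq_trans sq; rewrite sE; move: se sd; case: (size d) => [|[|k]] // _ _;
    rewrite !addnS /= ltnS leq_addr.
by apply: leq_trans sq; rewrite sE; move: se sd; case: (size e) => [|[|k]] // _ _;
  rewrite addSn /= addSn ltnS leq_addl.
Qed.

(** The irreducible polynomial [m] of [x] over [K] divides the separable polynomial of [x] over [F].
    Hence its image under [t] is separable too and has a root. *)
Lemma separable_closure_extend (F Fs K : fieldType) (iota : {rmorphism F -> Fs})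
    (s t : {rmorphism K -> Fs}) (j : {rmorphism F -> K}) (x : Fs) :
  separable_closure iota -> s \o j =1 iota -> t \o j =1 iota ->
  exists m y, [/\ irreducible_poly m, root (map_poly s m) x & root (map_poly t m) y].
Proof.
move=> hFs sj tj; have [q [qirr qsep qx]] := hFs.1 x.
have sJ : map_poly s (map_poly j q) = map_poly iota q.
  by rewrite -map_poly_comp; apply: eq_map_poly.
have tJ : map_poly t (map_poly j q) = map_poly iota q.
  by rewrite -map_poly_comp; apply: eq_map_poly.
have [m mirr mx] : exists2 m, irreducible_poly m & root (map_poly s m) x.
  apply: (@irreducible_root _ _ s (map_poly j q)); last by rewrite sJ.
  by rewrite map_poly_eq0 -size_poly_gt0 (ltn_trans _ qirr.1).
have [mq|[u [v]]] := irreducible_dichotomy mirr (map_poly j q); last first.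
  move/(congr1 (fun r => (map_poly s r).[x])).
  rewrite rmorphD !rmorphM rmorph1 !hornerE (rootP mx) /= sJ (rootP qx) !mulr0 addr0 => /eqP.
  by rewrite eq_sym oner_eq0.
have [y my] : exists y, root (map_poly t m) y.
  apply: hFs.2; last by rewrite size_map_poly mirr.1.
  by apply: (dvdp_separable (p := map_poly iota q));
    rewrite ?separable_map // -tJ dvdp_map.
by exists m, y.
Qed.

(** * Extending a graph by one element *)

Section GraphField.
Variables (F Fs : fieldType) (iota : {rmorphism F -> Fs}) (S : set (Fs * Fs)).
Hypothesis hFs : separable_closure iota.
Hypothesis hS : field_graph S.
Hypothesis Sa : forall a, S (iota a, iota a).

Definition graph_pred : {pred Fs * Fs} := fun z => `[< S z >].

Fact graph_divring : divring_closed graph_pred.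
Proof.
split; first by apply/asboolP; apply: graph1.
  by move=> z w /asboolP hz /asboolP hw; apply/asboolP; apply: graphB.
by move=> z w /asboolP hz /asboolP hw; apply/asboolP; apply: graphV.
Qed.
HB.instance Definition _ := GRing.isDivringClosed.Build _ graph_pred graph_divring.

(** The graph itself is made a field under componentwise operations, so that its two projections are
    the embeddings into [Fs] to be extended. *)
Record graph_field := GraphElt {
  graph_val :> Fs * Fs; graph_valP : graph_val \in graph_pred }.
HB.instance Definition _ := [isSub for graph_val].
HB.instance Definition _ := [Choice of graph_field by <:].
HB.instance Definition _ := [SubChoice_isSubComUnitRing of graph_field by <:].

Fact graph_field_unit : GRing.field_axiom graph_field.
Proof.
move=> z z0; have /asboolP hz := graph_valP z.
have z1 : (val z).1 != 0.
  apply: contra_neq z0 => e; apply: val_inj; rewrite rmorph0.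
  by apply/eqP/andP; split; rewrite /= ?e // -(graph_fun hS hz) e eqxx.
have z2 : (val z).2 != 0 by rewrite -(graph_fun hS hz).
have uz : val z \is a GRing.unit by apply/unitrP; exists ((val z).1^-1, (val z).2^-1);
  split; congr (_, _); rewrite /= ?mulVf ?mulfV.
have hV : (val z)^-1 \in graph_pred by rewrite -div1r; apply/asboolP;
  apply: graphV => //; apply: graph1.
by apply/unitrP; exists (GraphElt hV); split; apply: val_inj;
  rewrite rmorphM rmorph1 /= ?mulVr ?mulrV.
Qed.
HB.instance Definition _ := GRing.ComUnitRing_isField.Build graph_field graph_field_unit.

Lemma graph_extend (x : Fs) :
  exists S', [/\ field_graph S', S `<=` S' & exists y, S' (x, y)].
Proof.
pose K : fieldType := graph_field.
pose s : {rmorphism K -> Fs} := fst \o (val : K -> Fs * Fs).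
pose t : {rmorphism K -> Fs} := snd \o (val : K -> Fs * Fs).
have jP a : (iota a, iota a) \in graph_pred by apply/asboolP.
pose j a : K := GraphElt (jP a).
have ja : zmod_morphism j by move=> a b; apply: val_inj; rewrite [RHS]rmorphB /=;
  congr (_, _); rewrite rmorphB.
have jm : monoid_morphism j.
  by split=> [|a b]; apply: val_inj; rewrite ?[RHS]rmorph1 ?[RHS]rmorphM /=;
    congr (_, _); rewrite ?rmorph1 ?rmorphM.
pose jA := GRing.isZmodMorphism.Build _ _ j ja.
pose jM := GRing.isMonoidMorphism.Build _ _ j jm.
pose J : {rmorphism F -> K} := HB.pack j jA jM.
have [m [y [mirr mx my]]] :=
  @separable_closure_extend _ _ _ iota s t J x hFs (fun=> erefl) (fun=> erefl).
exists (adjoin_graph s t x y); split.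
- exact: adjoin_field_graph mirr mx my.
- move=> z Sz; have zP : z \in graph_pred by apply/asboolP.
  by have := adjoin_graph_base (s := s) (t := t) (x := x) (y := y) (GraphElt zP);
    case: z Sz zP.
- by exists y; apply: adjoin_graph_gen.
Qed.
End GraphField.

Lemma graphM (K : fieldType) (S : set (K * K)) z w :
  field_graph S -> S z -> S w -> S (z * w).
Proof.
move=> hS hz hw; rewrite -[w]invrK -[w^-1]div1r.
by apply: graphV => //; apply: graphV => //; apply: graph1.
Qed.

Lemma finite_roots (K : fieldType) (p : {poly K}) : p != 0 ->
  exists2 rs : seq K, uniq rs & rs =i root p.
Proof.
have [n] := ubnP (size p); elim: n p => // n IHn p /ltnSE sp p0.
have [[x px]|nroot] := pselect (exists x, root p x); last first.
  by exists [::] => // x; apply/esym/negP => px; apply: nroot; exists x.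
have [q pE] := factor_theorem _ _ px.
have q0 : q != 0 by apply: contraNneq p0 => q0; rewrite pE q0 mul0r.
have sq : (size q < n)%N.
  by apply: leq_trans sp; rewrite pE size_Mmonic ?monicXsubC // size_XsubC addn2.
have [rs rsu rsP] := IHn q sq q0.
exists (undup (x :: rs)); first exact: undup_uniq.
by move=> y; rewrite mem_undup inE rsP pE [RHS]rootM root_XsubC orbC.
Qed.

(** * The fixed field of the absolute Galois group *)

Section Galois.
Variables (F Fs : fieldType) (iota : {rmorphism F -> Fs}).
Hypothesis hFs : separable_closure iota.

(** The isomorphism F(x) -> F(y) over [F] is a starting graph. A maximal graph above [F] has full
    domain, since [graph_extend] would otherwise enlarge it. *)
Lemma maximal_graph (x y : Fs) (q : {poly F}) :
  irreducible_poly q -> root (map_poly iota q) x -> root (map_poly iota q) y ->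
  exists S, [/\ field_graph S, S (x, y), forall a, S (iota a, iota a) &
    forall z, exists w, S (z, w)].
Proof.
move=> qirr qx qy.
(* Zorn_bigcup also asks for the empty chain, whence the case of set0. *)
pose P S := S = set0 \/ [/\ field_graph S, S (x, y) & forall a, S (iota a, iota a)].
have chainP C : C `<=` P -> total_on C subset -> P (\bigcup_(X in C) X).
  move=> CP Ctot.
  have [[S CS S0]|C0] := pselect (exists2 S, C S & S !=set0); last first.
    left; apply/seteqP; split=> // z [S CS Sz]; apply: C0; exists S => //.
    by exists z.
  have CP' S' z : C S' -> S' z ->
    [/\ field_graph S', S' (x, y) & forall a, S' (iota a, iota a)].
    by move=> /CP [-> //|].
  have join2 z w : (\bigcup_(X in C) X) z -> (\bigcup_(X in C) X) w ->
      exists S', [/\ C S', field_graph S', S' z & S' w].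
    move=> [A CA Az] [B CB Bw].
    have [/(_ _ Az) Bz|/(_ _ Bw) Aw] := Ctot _ _ CA CB.
      by exists B; split=> //; case: (CP' _ _ CB Bw).
    by exists A; split=> //; case: (CP' _ _ CA Az).
  have [z Sz] := S0; have [hS Sxy Sa] := CP' _ _ CS Sz.
  right; split; [split| |].
  - by exists S => //; apply: graph1.
  - by move=> u v hu hv; have [S' [CS' hS' S'u S'v]] := join2 _ _ hu hv;
      exists S' => //; apply: graphB.
  - by move=> u v hu hv; have [S' [CS' hS' S'u S'v]] := join2 _ _ hu hv;
      exists S' => //; apply: graphV.
  - by move=> u [S' CS' S'u]; case: (CP' _ _ CS' S'u) => hS' _ _; apply: (graph_fun hS').
  - by exists S.
  - by move=> a; exists S.
have [S [PS Smax]] := Zorn_bigcup chainP.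
have hS0 : field_graph (adjoin_graph iota iota x y) by apply: adjoin_field_graph qirr _ _.
have {PS} [hS Sxy Sa] : [/\ field_graph S, S (x, y) & forall a, S (iota a, iota a)].
  case: PS => // S0; exfalso; apply: (Smax (adjoin_graph iota iota x y)).
    by rewrite S0; split=> // /(_ _ (graph1 hS0)).
  by right; split=> // [|a]; [apply: adjoin_graph_gen|apply: adjoin_graph_base].
exists S; split=> // z.
have [S' [hS' SS' [w S'zw]]] := graph_extend hFs hS Sa z.
exists w; apply: contrapT => nSzw; apply: (Smax S').
  by split=> // /(_ _ S'zw).
by right; split=> // [|a]; apply: SS'.
Qed.

(** The finite set of roots of a polynomial over [F] is mapped injectively into itself, hence onto
    itself. *)
Lemma endo_bij (s : {rmorphism Fs -> Fs}) :
  (forall a, s (iota a) = iota a) -> bijective s.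
Proof.
move=> sfix.
have ssurj y : exists x, s x = y.
  have [q [qirr _ qy]] := hFs.1 y.
  have q0 : map_poly iota q != 0 by rewrite map_poly_eq0 -size_poly_gt0 (ltn_trans _ qirr.1).
  have [rs rsu rsP] := finite_roots q0.
  have sq : map_poly s (map_poly iota q) = map_poly iota q.
    by rewrite -map_poly_comp; apply: eq_map_poly.
  have srs : {subset map s rs <= rs}.
    move=> w /mapP [z + ->]; rewrite !rsP => qz.
    by change (root (map_poly iota q) (s z)); rewrite -sq fmorph_root.
  have su : uniq (map s rs) by rewrite map_inj_uniq //; apply: fmorph_inj.
  have [|_ rsE] := uniq_min_size su srs; first by rewrite size_map.
  have : y \in rs by rewrite rsP.
  by rewrite -rsE => /mapP [z _ ->]; exists z.
have [t ts] := choice ssurj.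
by exists t => // x; apply: (fmorph_inj s); rewrite ts.
Qed.

Lemma absGal_conjugate (x y : Fs) (q : {poly F}) :
  irreducible_poly q -> root (map_poly iota q) x -> root (map_poly iota q) y ->
  exists s : absGal iota, s x = y.
Proof.
move=> qirr qx qy; have [S [hS Sxy Sa Stot]] := maximal_graph qirr qx qy.
have [s sS] := choice Stot.
(* Two pairs over the same [z] have a difference with first coordinate 0, so by [graph_fun] its
   second coordinate is 0. *)
have Sfun z w : S (z, w) -> s z = w.
  move=> Szw; apply/eqP; rewrite -subr_eq0.
  by have := graph_fun hS (graphB hS (sS z) Szw); rewrite /= subrr eqxx => <-.
have sB : zmod_morphism s.
  by move=> u v; apply: Sfun; have := graphB hS (sS u) (sS v).
have s1 : s 1 = 1 by apply: Sfun; apply: (graph1 hS).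
have sM : monoid_morphism s.
  by split=> // u v; apply: Sfun; apply: (graphM hS (sS u) (sS v)).
pose sA := GRing.isZmodMorphism.Build _ _ s sB.
pose sMM := GRing.isMonoidMorphism.Build _ _ s sM.
pose sr : {rmorphism Fs -> Fs} := HB.pack s sA sMM.
have sfix a : sr (iota a) = iota a by apply: Sfun.
by exists (AbsGal (endo_bij sfix) sfix); apply: Sfun.
Qed.

(** If the separable irreducible polynomial of [x] had degree above 1, it would have a root other
    than [x], and some automorphism would move [x] there. *)
Lemma absGal_fixed (x : Fs) :
  (forall s : absGal iota, s x = x) -> exists a, x = iota a.
Proof.
move=> xfix; have [q [qirr qsep qx]] := hFs.1 x.
have q0 : q != 0 by rewrite -size_poly_gt0 (ltn_trans _ qirr.1).
have [/eqP q2|q2] := boolP (size q == 2%N).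
  have q1 : q`_1 != 0 by rewrite -[1%N]/(2.-1) -q2 -lead_coefE lead_coef_eq0.
  exists (- q`_0 / q`_1); move: qx => /rootP;
    rewrite (horner_coef_wide _ (n := 2)) ?size_map_poly ?q2 //.
  rewrite !big_ord_recl big_ord0 !coef_map /= expr0 expr1 mulr1 addr0 => /eqP.
  rewrite addrC addr_eq0 mulrC => /eqP e.
  by rewrite rmorphM fmorphV rmorphN -e mulfK // fmorph_eq0.
have [r qE] : exists r, map_poly iota q = r * ('X - x%:P) by apply/factor_theorem.
have : separable_poly (map_poly iota q) by rewrite separable_map.
rewrite qE separable_mul => /and3P [rsep _ rcop].
have r1 : (1 < size r)%N.
  have := congr1 (fun p : {poly Fs} => size p) qE.
  rewrite size_map_poly size_Mmonic ?monicXsubC //; last first.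
    by apply: contraNneq q0 => r0; rewrite -(map_poly_eq0 iota) qE r0 mul0r.
  move: qirr.1 q2; rewrite size_XsubC addn2 => + + e; rewrite e /=.
  by case: (size r) => [|[|k]].
have [y ry] := hFs.2 r rsep r1.
have [|s sxy] := @absGal_conjugate x y q qirr qx.
  by rewrite qE rootM ry.
move: rcop; rewrite coprimep_XsubC.
by rewrite -[X in root r X](xfix s) sxy ry.
Qed.
End Galois.

(** * Hilbert 90 *)

(** Dedekind's argument: multiplying a relation by chi t0 x0 and subtracting it from the relation at
    x0 x eliminates [t0]. Everything is tested on a submonoid [D] only, because the characters used
    later are compared on a fixed subfield. *)
Lemma dedekind_independence (T : eqType) (K L : fieldType) (D : set K)
    (chi : T -> K -> L) :
  D 1 -> (forall x y, D x -> D y -> D (x * y)) -> (forall t, chi t 1 = 1) ->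
  (forall t x y, chi t (x * y) = chi t x * chi t y) ->
  forall r : seq T, uniq r ->
    (forall t t', t \in r -> t' \in r -> t != t' ->
      exists2 x, D x & chi t x != chi t' x) ->
  forall a : T -> L, (forall x, D x -> \sum_(t <- r) a t * chi t x = 0) ->
  forall t, t \in r -> a t = 0.
Proof.
move=> D1 DM chi1 chiM; elim=> // t0 r IHr /= /andP [t0r ru] sep a rel.
have a0 t : t \in r -> a t = 0.
  move=> tr; have t0t : t0 != t by apply: contraNneq t0r => ->.
  have [x0 Dx0 ne] := sep t0 t (mem_head _ _) (mem_behead (s := t0 :: r) tr) t0t.
  suff : a t * (chi t x0 - chi t0 x0) = 0.
    by move/eqP; rewrite mulf_eq0 subr_eq0 [chi t x0 == _]eq_sym (negPf ne) orbF => /eqP.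
  apply: (IHr ru _ (fun t => a t * (chi t x0 - chi t0 x0))) => //.
    by move=> u v ur vr; apply: sep; rewrite inE ?ur ?vr orbT.
  move=> x Dx; have := rel _ (DM _ _ Dx0 Dx); have := rel _ Dx.
  rewrite !big_cons !chiM => /(congr1 (fun z => chi t0 x0 * z)) e1 e2.
  transitivity (a t0 * (chi t0 x0 * chi t0 x) + \sum_(j <- r) a j * chi j (x0 * x)
    - chi t0 x0 * (a t0 * chi t0 x + \sum_(j <- r) a j * chi j x)); last first.
    by rewrite e1 e2 mulr0 subr0.
  rewrite mulrDr mulr_sumr opprD addrACA mulrCA subrr add0r -sumrB.
  by apply: eq_bigr => j _; rewrite chiM; ring.
move=> t; rewrite inE => /predU1P [->|/a0 //].
have := rel _ D1; rewrite big_cons chi1 mulr1 big_seq big1 ?addr0 // => j /a0 ->.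
by rewrite mul0r.
Qed.

Lemma det2E (R : comNzRingType) (A : 'M[R]_2) : \det A = A 0 0 * A 1 1 - A 0 1 * A 1 0.
Proof.
rewrite (expand_det_row _ 0) !big_ord_recl big_ord0 /cofactor !det_mx11 !mxE.
rewrite /= (_ : lift 0 0 = 1 :> 'I_2); last exact: val_inj.
rewrite (_ : lift 1 0 = 0 :> 'I_2); last exact: val_inj.
by rewrite expr0 expr1; ring.
Qed.

(** * Triviality of continuous cocycles in GL2 and SL2 *)

Section Hilbert90.
Variables (F Fs : fieldType) (iota : {rmorphism F -> Fs}).
Hypothesis hFs : separable_closure iota.
Implicit Types s t : absGal iota.

(** An automorphism sends each entry of [X] to a root of the same polynomial over [F], which leaves
    finitely many images. The orbit stands for the finite set of cosets of the stabilizer of [X]. *)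
Lemma finite_orbit (X : seq Fs) :
  exists2 r : seq (seq Fs), uniq r &
    forall o, o \in r <-> exists s : absGal iota, o = map s X.
Proof.
have [l lP] : exists l : seq (seq Fs), forall s : absGal iota, map s X \in l.
  elim: X => [|x X [l lP]]; first by exists [:: [::]].
  have [q [qirr _ qx]] := hFs.1 x.
  have q0 : map_poly iota q != 0 by rewrite map_poly_eq0 -size_poly_gt0 (ltn_trans _ qirr.1).
  have [rs _ rsP] := finite_roots q0.
  exists [seq y :: o | y <- rs, o <- l] => s; apply/allpairsP; exists (s x, map s X).
  split=> //=; rewrite rsP; change (root (map_poly iota q) (s x)).
  have -> : map_poly iota q = map_poly s (map_poly iota q).
    by rewrite -map_poly_comp; apply: eq_map_poly => a /=; rewrite gal_fix.
  by rewrite fmorph_root.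
exists (undup [seq o <- l | `[< exists s : absGal iota, o = map s X >]]);
  first exact: undup_uniq.
move=> o; rewrite mem_undup mem_filter; split=> [/andP [/asboolP //]|[s ->]].
by rewrite lP andbT; apply/asboolP; exists s.
Qed.

Section Cocycle.
Variable C : absGal iota -> 'M[Fs]_2.
Hypothesis Ccont : krull_continuous C.
Hypothesis Cunit : forall s, C s \in unitmx.
Hypothesis CM : forall s t, C (s * t)%g = C s *m map_mx s (C t).

(** The columns tried are the sums of s(d) C(s) e_j over representatives [s] of the orbit. If [a]
    killed all of them, independence of characters would give a C(s) = 0, against invertibility of
    C(s). *)
Lemma fixed_column (a : 'rV[Fs]_2) : a != 0 ->
  exists u : 'cV[Fs]_2, (forall s, C s *m map_mx s u = u) /\ a *m u != 0.
Proof.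
move=> a0; have [X CX] := Ccont 1%g.
have agree s t : map s X = map t X -> {in X, (t^-1 * s)%g =1 idfun}.
  move=> /eq_in_map st x xX; change ((t^-1)%g (s x) = x).
  by rewrite st //; change ((t^-1 * t)%g x = x); rewrite mulVg.
have Cext s t : map s X = map t X -> C s = C t.
  move=> st; rewrite -[s](mulVKg t) CM (CX (t^-1 * s)%g); last exact: agree.
  by rewrite -CM mulg1.
(* The fixed field of the pointwise stabilizer of [X]: on it, as for [C], the effect of [s] depends
   only on the image of [X]. *)
pose D : set Fs := [set d | forall t : absGal iota, {in X, t =1 idfun} -> t d = d].
have Dext s t d : D d -> map s X = map t X -> s d = t d.
  by move=> Dd /agree /Dd e; rewrite -[in RHS]e; change (s d = (t * (t^-1 * s))%g d);
    rewrite mulVKg.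
have [r ru rP] := finite_orbit X.
have /choice [rep repP] : forall o, exists s : absGal iota, o \in r -> o = map s X.
  move=> o; have [/rP [s e]|nr] := boolP (o \in r); first by exists s.
  by exists 1%g.
apply: contrapT => H.
suff aC o j : o \in r -> (a *m C (rep o)) 0 j = 0.
  have or : map (1%g : absGal iota) X \in r by apply/rP; exists 1%g.
  move/negP: a0; apply; rewrite -(mulmxK (Cunit (rep (map (1%g : absGal iota) X))) a).
  rewrite (_ : a *m _ = 0) ?mul0mx //; by apply/rowP => j; rewrite [RHS]mxE; apply: aC.
apply: (@dedekind_independence _ _ _ D (fun o => rep o) _ _ _ _ r ru _
  (fun o => (a *m C (rep o)) 0 j)).
- by move=> t _; apply: rmorph1.
- by move=> x y Dx Dy t tX; rewrite rmorphM Dx ?Dy.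
- by move=> t; apply: rmorph1.
- by move=> t x y; apply: rmorphM.
(* The entries of [X] lie in [D], so different images of [X] are separated by an element of [D]. *)
- move=> o1 o2 or1 or2 ne; apply: contrapT => same; move/eqP: ne; apply.
  rewrite (repP _ or1) (repP _ or2); apply/eq_in_map => x xX; apply/eqP/negP => /negP ne.
  by apply: same; exists x => // t tX; apply: tX.
move=> d Dd; apply: contrapT => /eqP ne; apply: H.
(* Averaging over the orbit of X makes the column invariant. *)
exists (\sum_(o <- r) rep o d *: (C (rep o) *m delta_mx j 0)); split.
  move=> s; rewrite raddf_sum mulmx_sumr /=.
  have smap o1 : o1 \in r -> map s o1 = map (s * rep o1)%g X.
    by move=> or1; rewrite [in LHS](repP _ or1) -map_comp.
  have perm_r : perm_eq (map (map s) r) r.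
    have injs : injective (map s) by apply: inj_map; apply: fmorph_inj.
    have su : uniq (map (map s) r) by rewrite map_inj_uniq.
    have ss : {subset map (map s) r <= r}.
      by move=> _ /mapP [o1 or1 ->]; apply/rP; exists (s * rep o1)%g; apply: smap.
    have [|_ rE] := uniq_min_size su ss; first by rewrite size_map.
    exact: uniq_perm.
  rewrite -[RHS](perm_big _ perm_r) big_map /= big_seq [RHS]big_seq;
    apply: eq_bigr => o1 or1.
  have e : map (rep (map s o1)) X = map (s * rep o1)%g X.
    by rewrite -smap // -repP //; apply/rP; exists (s * rep o1)%g; apply: smap.
  rewrite (Cext _ _ e) (Dext _ _ _ Dd e) map_mxZ map_mxM map_delta_mx -scalemxAr mulmxA.
  by rewrite -CM.
apply: contra_neq ne => /matrixP /(_ 0 0); rewrite mulmx_sumr summxE mxE => sum0.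
rewrite -[RHS]sum0; apply: eq_bigr => o1 _.
by rewrite -scalemxAr mulmxA -colE !mxE mulrC.
Qed.

(** The second invariant column is taken off the kernel of the row (- u1, u0), whose product with it
    is the determinant of the two columns. *)
Lemma cocycle_trivial_GL2 : exists2 h : 'M[Fs]_2, h \in unitmx &
  forall s, C s *m map_mx s h = h.
Proof.
have [|u [Cu u0]] := @fixed_column (delta_mx 0 0) _.
  by apply/rV0Pn; exists 0; rewrite mxE !eqxx oner_eq0.
have [|v [Cv v0]] := @fixed_column (\row_j if j == 0 then - u 1 0 else u 0 0) _.
  apply: contra_neq u0 => /rowP a0; suff -> : u = 0 by rewrite mulmx0.
  apply/colP => i; rewrite mxE; have [->|->] : i = 0 \/ i = 1.
  - by case: i => [[|[|]] //= ?]; [left|right]; apply: val_inj.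
  - by have := a0 1; rewrite !mxE.
  - by have := a0 0; rewrite !mxE eqxx => /eqP; rewrite oppr_eq0 => /eqP.
exists (\matrix_(i, j) if j == 0 then u i 0 else v i 0); last first.
  move=> s; apply/matrixP => i j; rewrite !mxE.
  have [j0|j0] := eqVneq j 0.
    rewrite -[in RHS](Cu s) mxE; apply: eq_bigr => l _.
    by rewrite !mxE j0.
  rewrite -[in RHS](Cv s) mxE; apply: eq_bigr => l _.
  by rewrite !mxE (negPf j0).
rewrite unitmxE unitfE; apply: contra_neq v0; rewrite det2E !mxE /= => e.
apply/rowP => i; rewrite !ord1 !mxE !big_ord_recl big_ord0 !mxE /= -[RHS]e.
rewrite (_ : lift ord0 ord0 = 1 :> 'I_2); last exact: val_inj.
by rewrite addr0 addrC mulNr [v 0 0 * _]mulrC.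
Qed.

Lemma cocycle_trivial_SL2 : (forall s, \det (C s) = 1) ->
  exists2 g : 'M[Fs]_2, \det g = 1 & forall s, map_mx s g = g *m C s.
Proof.
move=> Cdet; have [h hu hC] := cocycle_trivial_GL2.
have [e he] : exists e, \det h = iota e.
  apply: (absGal_fixed hFs) => s.
  by rewrite -[in RHS](hC s) det_mulmx Cdet mul1r det_map_mx.
have e0 : iota e != 0 by rewrite -he -unitfE -unitmxE.
(* Dividing the first column by the determinant is a right multiplication by a matrix over [F],
   which keeps the invariance under the cocycle. *)
pose dg : 'M[F]_2 := diag_mx (\row_j if j == 0 then e^-1 else 1).
pose h' := h *m map_mx iota dg.
have h'1 : \det h' = 1.
  rewrite det_mulmx det_map_mx det_diag !big_ord_recl big_ord0 !mxE /= !mulr1 fmorphV he.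
  by rewrite mulfV.
have h'u : h' \in unitmx by rewrite unitmxE h'1 unitr1.
have h'C s : C s *m map_mx s h' = h'.
  rewrite map_mxM mulmxA hC -map_mx_comp; congr (_ *m _).
  by apply/matrixP => i j; rewrite !mxE /= gal_fix.
exists (invmx h'); first by rewrite det_inv h'1 invr1.
move=> s; rewrite map_invmx.
have su : map_mx s h' \in unitmx by rewrite map_unitmx.
by apply: (can_inj (mulmxK su)); rewrite mulVmx // -mulmxA h'C mulVmx.
Qed.
End Cocycle.
End Hilbert90.

(** * The form 3 u^2 v + k v^3 *)

Definition mx2 (R : comNzRingType) (a b c d : R) : 'M[R]_2 :=
  \matrix_(i, j) if i == 0 then if j == 0 then a else b else if j == 0 then c else d.

Lemma ord2P (i : 'I_2) : i = 0 \/ i = 1.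
Proof. by case: i => [[|[|]] //= ?]; [left|right]; apply: val_inj. Qed.

Lemma mx2E (R : comNzRingType) (A : 'M[R]_2) : A = mx2 (A 0 0) (A 0 1) (A 1 0) (A 1 1).
Proof. by apply/matrixP => i j; rewrite !mxE; case: (ord2P i) => ->;
  case: (ord2P j) => ->. Qed.

Lemma det_mx2 (R : comNzRingType) (a b c d : R) : \det (mx2 a b c d) = a * d - b * c.
Proof. by rewrite det2E !mxE. Qed.

Lemma mul_mx2 (R : comNzRingType) (a b c d a' b' c' d' : R) :
  mx2 a b c d *m mx2 a' b' c' d' =
  mx2 (a * a' + b * c') (a * b' + b * d') (c * a' + d * c') (c * b' + d * d').
Proof.
by rewrite [LHS]mx2E !mxE !big_ord_recl !big_ord0 !mxE /= !addr0.
Qed.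

Lemma map_mx2 (R S : comNzRingType) (s : {rmorphism R -> S}) (a b c d : R) :
  map_mx s (mx2 a b c d) = mx2 (s a) (s b) (s c) (s d).
Proof. by rewrite [LHS]mx2E !mxE. Qed.

Section BaseForm.
Variables (K : fieldType) (k : K).
Hypotheses (h2 : 2%:R != 0 :> K) (h3 : 3%:R != 0 :> K) (hk : k != 0).

Definition base_form : bcf K := Bcf 0 1 0 k.

(** When y^2 = -27k the matrix has trace -1 and determinant 1, so it is a root of X^2 + X + 1 and
    has order 3, as does the point (0, y). *)
Definition kermx_point (P : Defs.point K) : 'M[K]_2 :=
  if P is Some (_, y) then mx2 (- 2^-1) (y / (6 * k)) (y / 6) (- 2^-1) else 1%:M.

Definition ker_mx (P : kerphi k) : 'M[K]_2 := kermx_point P.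

Let h6 : 6%:R != 0 :> K. Proof. by rewrite (natrM _ 2 3) mulf_neq0. Qed.
Let h4 : 4%:R != 0 :> K. Proof. by rewrite (natrM _ 2 2) mulf_neq0. Qed.
Let h36 : 36%:R != 0 :> K. Proof. by rewrite (natrM _ 6 6) mulf_neq0. Qed.
Let h8 : 8%:R != 0 :> K. Proof. by rewrite (natrM _ 4 2) mulf_neq0. Qed.

Let nz := (h2, h4, h6, h8, h36, hk).

Lemma ker_mx0 : ker_mx 0 = 1%:M. Proof. by []. Qed.

(** Apart from the identity there are two cases: opposite points, whose matrices are inverse, and
    equal points, where doubling is negation as squaring a matrix of order 3 is inversion. *)
Lemma ker_mxD P Q : ker_mx (P + Q) = ker_mx P *m ker_mx Q.
Proof.
rewrite /ker_mx; change (ker_point (P + Q)) with (ec_add P Q).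
have [->|[y -> hy]] := kerphi_cases P; first by rewrite mul1mx.
have [->|[z -> hz]] := kerphi_cases Q; first by rewrite mulmx1.
rewrite ec_add_x0 /= mul_mx2; case: eqVneq => [e|ne] /=.
  rewrite [LHS]mx2E !mxE /= e; congr mx2.
  (* The middle term isolates the square z^2, to be replaced by -27k. *)
  - transitivity (4^-1 - z ^+ 2 / (36 * k)); [rewrite hz|]; by field; rewrite ?nz.
  - by ring.
  - by ring.
  - transitivity (4^-1 - z ^+ 2 / (36 * k)); [rewrite hz|]; by field; rewrite ?nz.
have {ne} -> : z = y.
  have /eqP : y ^+ 2 = z ^+ 2 by rewrite hy hz.
  by rewrite eqf_sqr (negPf ne) orbF => /eqP ->.
congr mx2.
- transitivity (4^-1 + y ^+ 2 / (36 * k)); [rewrite hy|]; by field; rewrite ?nz.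
- by field; rewrite ?nz.
- by field; rewrite ?nz.
- transitivity (4^-1 + y ^+ 2 / (36 * k)); [rewrite hy|]; by field; rewrite ?nz.
Qed.

Lemma ker_mx_stab P : SL2_stab base_form (ker_mx P).
Proof.
rewrite /ker_mx; have [->|[y -> hy]] := kerphi_cases P.
  by split; [apply: det1|apply: bcf_act1].
split.
  rewrite /SL2 /= det_mx2; transitivity (4^-1 - y ^+ 2 / (36 * k)); [|rewrite hy];
    by field; rewrite ?nz.
rewrite /= !mxE /=; congr Bcf.
- transitivity (y / (6 * k) * (3 / 4 + y ^+ 2 / (36 * k))); [|rewrite hy];
    by field; rewrite ?nz.
- transitivity (- 2^-1 / 4 - y ^+ 2 / (36 * k) * (3 / 2)); [|rewrite hy];
    by field; rewrite ?nz.
- transitivity (y / 6 * (3 / 4 + y ^+ 2 / (36 * k))); [|rewrite hy];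
    by field; rewrite ?nz.
- transitivity (- 3 / 2 * y ^+ 2 / 36 - k / 8); [|rewrite hy]; by field; rewrite ?nz.
Qed.

(** The corner entry separates the identity from the other matrices, since 1 = -1/2 would mean 3 =
    0; the lower left entry y / 6 then recovers [y]. *)
Lemma ker_mx_inj : injective ker_mx.
Proof.
have half : 1 = - 2^-1 :> K -> False.
  move=> /(congr1 ( *%R 2)); rewrite mulr1 mulrN mulfV // => /eqP.
  by rewrite -addr_eq0 natr1 (negPf h3).
move=> P Q; rewrite /ker_mx => e; apply: val_inj => /=; move: e.
have [->|[y -> hy]] := kerphi_cases P; have [->|[z -> hz]] := kerphi_cases Q => //=.
- by move/matrixP/(_ 0 0); rewrite !mxE /= => /half.
- by move/matrixP/(_ 0 0); rewrite !mxE /= => /esym /half.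
by move/matrixP/(_ 1 0); rewrite !mxE /= => /(divIf h6) ->.
Qed.

(** If q = 0 the equations force the identity. Otherwise they force p = s = -1/2 and r = k q, and
    comparing q with y / (6k) gives the point with y = 6 k q. *)
Lemma ker_mx_surj g : SL2_stab base_form g -> exists P, ker_mx P = g.
Proof.
case; rewrite (mx2E g) /SL2 /= !mxE /= det_mx2.
move: (g 0 0) (g 0 1) (g 1 0) (g 1 1) => p q r s dt [ea eb ec _].
have {}dt : p * s - q * r - 1 = 0 by rewrite dt subrr.
have {}ea : q * (3 * p ^+ 2 + k * q ^+ 2) = 0 by rewrite -[RHS]ea; ring.
have {}eb : p ^+ 2 * s + 2 * p * q * r + k * q ^+ 2 * s - 1 = 0.
  by apply/eqP; rewrite subr_eq0; apply/eqP; rewrite -[RHS]eb; ring.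
have {}ec : q * r ^+ 2 + 2 * p * r * s + k * q * s ^+ 2 = 0 by rewrite -[RHS]ec; ring.
have [q0|q0] := eqVneq q 0.
  have ps : p * s = 1 by apply/eqP; rewrite -subr_eq0 -dt q0 mul0r subr0.
  have p1 : p = 1.
    by apply/eqP; rewrite -subr_eq0 -[X in _ == X]eb q0 -{1}[p]mulr1 -ps; apply/eqP; ring.
  have s1 : s = 1 by rewrite -ps p1 mul1r.
  have r0 : r = 0.
    by apply: (mulfI h2); rewrite mulr0 -[RHS]ec q0 p1 s1; ring.
  by exists 0; rewrite ker_mx0 [LHS]mx2E !mxE /= q0 p1 s1 r0.
have {}ea : 3 * p ^+ 2 + k * q ^+ 2 = 0 by apply: (mulfI q0); rewrite mulr0.
have hp : - (2 * p) = 1.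
  apply/eqP; rewrite -subr_eq0; apply/eqP.
  transitivity ((p ^+ 2 * s + 2 * p * q * r + k * q ^+ 2 * s - 1)
     - s * (3 * p ^+ 2 + k * q ^+ 2) + 2 * p * (p * s - q * r - 1)); first by ring.
  by rewrite ea eb dt; ring.
(* Eliminating k from [ea] and [ec] leaves (p s - q r)(q r + 3 p s) = 0, whose first factor is 1. *)
have e4 : q * r + 3 * p * s = 0.
  transitivity (s ^+ 2 * (3 * p ^+ 2 + k * q ^+ 2)
    - q * (q * r ^+ 2 + 2 * p * r * s + k * q * s ^+ 2)
    - (q * r + 3 * p * s) * (p * s - q * r - 1)); first by ring.
  by rewrite ea ec dt; ring.
have hs : - (2 * s) = 1.
  transitivity (- (2 * s) * - (2 * p)); first by rewrite hp mulr1.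
  apply/eqP; rewrite -subr_eq0; apply/eqP.
  transitivity ((p * s - q * r - 1) + (q * r + 3 * p * s)); first by ring.
  by rewrite dt e4 addr0.
have half (x : K) : - (2 * x) = 1 -> x = - 2^-1.
  by move=> e; apply: (mulfI h2); apply: oppr_inj; rewrite e mulrN opprK mulfV.
have rE : r = k * q.
  apply: (mulfI q0); apply/eqP; rewrite -subr_eq0; apply/eqP.
  transitivity ((q * r + 3 * p * s) - (3 * p ^+ 2 + k * q ^+ 2) + 3 * p * (p - s));
    first by ring.
  by rewrite e4 ea (half _ hp) (half _ hs); ring.
have hP : on_curve (- 27 * k) (Some (0, 6 * k * q)) &&
    (hatphi k (Some (0, 6 * k * q)) == None).
  rewrite /= eqxx andbT; apply/eqP.
  transitivity (36 * k * (3 * p ^+ 2 + k * q ^+ 2) - 27 * k * (- (2 * p)) ^+ 2);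
    first by ring.
  by rewrite ea hp; ring.
exists (KerPhi hP); rewrite /ker_mx /= (half _ hp) (half _ hs) rE; congr mx2.
  by field; rewrite h6 hk.
by field; rewrite h6.
Qed.

(** * Reduction of a form with a zero to the base form *)

Lemma bcf_act_inv (g : 'M[K]_2) (f f' : bcf K) :
  \det g = 1 -> bcf_act g f = f' -> bcf_act (invmx g) f' = f.
Proof.
by move=> g1 <-; rewrite -bcf_actM mulVmx ?bcf_act1 // unitmxE g1 unitr1.
Qed.

(** A unimodular matrix with first row (u, v) moves the zero to (1, 0), so that a = 0. The
    discriminant then has the factor b, which is therefore nonzero. *)
Lemma root_base_orbit (f : bcf K) (u v : K) : disc f = 4 * k ->
  (u != 0) || (v != 0) -> bcf_eval f u v = 0 ->
  exists2 g, \det g = 1 & bcf_act g base_form = f.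
Proof.
move=> fk uv fuv.
have [g [g1 gu gv]] : exists g : 'M[K]_2, [/\ \det g = 1, g 0 0 = u & g 0 1 = v].
  have [u0|u0] := eqVneq u 0.
    have v0 : v != 0 by rewrite u0 eqxx in uv.
    by exists (mx2 u v (- v^-1) 0); rewrite det_mx2 !mxE mulr0 mulrN mulfV // sub0r opprK.
  by exists (mx2 u v 0 u^-1); rewrite det_mx2 !mxE mulr0 mulfV // subr0.
have := bcf_eval_act g f 1 0; rewrite !mul1r !mul0r !addr0 gu gv fuv.
have := disc_act g f; rewrite g1 expr1n mul1r fk.
case E : (bcf_act g f) => [a b c d] /= hd ha.
have {ha}a0 : a = 0 by rewrite -[RHS]ha; ring.
have {}hd : b * (4 * b ^+ 2 * d - 3 * b * c ^+ 2) = 4 * k by rewrite -hd a0; ring.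
have b0 : b != 0.
  by apply: contraTneq (mulf_neq0 h4 hk) => b0; rewrite -hd b0 mul0r eqxx.
(* The diagonal scales b to 1 and the entry - c / 2 removes the third coefficient; the discriminant
   then makes the last one equal to k. *)
pose g' := mx2 b^-1 0 (- c / 2) b.
have g'1 : \det g' = 1 by rewrite det_mx2 mul0r subr0 mulVf.
exists (invmx (g' *m g)); first by rewrite det_inv det_mulmx g1 g'1 mul1r invr1.
apply: (@bcf_act_inv (g' *m g) f base_form); first by rewrite det_mulmx g1 g'1 mul1r.
rewrite bcf_actM E /= !mxE /= a0; congr Bcf.
- by ring.
- by field; rewrite ?h2 ?b0.
- by field; rewrite ?h2 ?b0.
apply: (mulfI h4); rewrite -hd.
by field; rewrite ?h2 ?b0.
Qed.
End BaseForm.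

(** If a = 0 the zero is (1, 0). Otherwise the cubic in u obtained at v = 1 is separable because the
    discriminant is nonzero, and a root t gives the zero (t, 1). *)
Lemma cubic_zero (K : fieldType) (f : bcf K) : 3%:R != 0 :> K -> disc f != 0 ->
  (forall q : {poly K}, separable_poly q -> (1 < size q)%N -> exists x, root q x) ->
  exists u v : K, (u != 0) || (v != 0) /\ bcf_eval f u v = 0.
Proof.
case: f => a b c d h3 hd Ksep.
have [a0|a0] := eqVneq a 0.
  by exists 1, 0; rewrite oner_eq0; split=> //=; rewrite a0; ring.
pose p := Poly [:: d; 3 * c; 3 * b; a].
have sp : size p = 4%N by rewrite (@PolyK _ 0).
have pE : p = a%:P * 'X^3 + 3 * b%:P * 'X^2 + 3 * c%:P * 'X + d%:P.
  by rewrite /p /= !cons_poly_def !rmorphM /=; ring.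
suff psep : separable_poly p.
  have [|t /rootP pt] := Ksep p psep; first by rewrite sp.
  by exists t, 1; rewrite oner_eq0 orbT; split=> //=; rewrite -[RHS]pt pE !hornerE /=;
    ring.
rewrite separable_poly.unlock; apply/Bezout_coprimepP.
(* p and q = p'/3 leave the linear remainder L = a p - (a X + b) q = 2 A X + B,
   and (4 A^2) q = a disc(f) modulo L, with quotient W. *)
pose A := a * c - b ^+ 2; pose B := a * d - b * c.
pose W := a%:P * (2 * A%:P * 'X + B%:P) - (2 * a * B)%:P + (4 * b * A)%:P.
exists (- (3 * a)%:P * W, (4 * A ^+ 2)%:P + (a%:P * 'X + b%:P) * W).
suff -> : (- (3 * a)%:P * W, (4 * A ^+ 2)%:P + (a%:P * 'X + b%:P) * W).1 * p +
  (- (3 * a)%:P * W, (4 * A ^+ 2)%:P + (a%:P * 'X + b%:P) * W).2 * p^`() =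
    (3 * a * disc (Bcf a b c d))%:P.
  by rewrite polyC_eqp1 !mulf_neq0.
rewrite /= pE /W /A /B !derivE /=.
ring.
Qed.

(** * Forms and cohomology classes *)

Section MapForm.
Variables (R S : comNzRingType) (s : {rmorphism R -> S}).

Definition map_bcf (f : bcf R) : bcf S :=
  let: Bcf a b c d := f in Bcf (s a) (s b) (s c) (s d).

Lemma map_bcf_act g f : map_bcf (bcf_act g f) = bcf_act (map_mx s g) (map_bcf f).
Proof. by case: f => a b c d; rewrite /= !mxE; congr Bcf; ring. Qed.

Lemma disc_map_bcf f : disc (map_bcf f) = s (disc f).
Proof. by case: f => a b c d /=; ring. Qed.
End MapForm.

Lemma map_bcf_inj (K L : fieldType) (s : {rmorphism K -> L}) : injective (map_bcf s).
Proof.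
by move=> [a b c d] [a' b' c' d'] [] /fmorph_inj -> /fmorph_inj -> /fmorph_inj ->
  /fmorph_inj ->.
Qed.

Section Correspondence.
Variables (F Fs : fieldType) (iota : {rmorphism F -> Fs}) (k : F).
Hypothesis hFs : separable_closure iota.
Hypotheses (h2 : 2%:R != 0 :> F) (h3 : 3%:R != 0 :> F) (hk : k != 0).
Implicit Types (s t : absGal iota) (P Q : kerphi (iota k)) (f : bcf F)
  (c : absGal iota -> kerphi (iota k)).

Let k2 : 2%:R != 0 :> Fs. Proof. by rewrite -(rmorph_nat iota) fmorph_eq0. Qed.
Let k3 : 3%:R != 0 :> Fs. Proof. by rewrite -(rmorph_nat iota) fmorph_eq0. Qed.
Let kk : iota k != 0. Proof. by rewrite fmorph_eq0. Qed.

Let f0 := base_form (iota k).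
Let psiD P Q := ker_mxD k2 k3 kk P Q.
Let psiP P : SL2_stab f0 (ker_mx P) := ker_mx_stab k2 k3 kk P.
Let psi_det P : \det (ker_mx P) = 1 := (psiP P).1.
Let psi_fix P : bcf_act (ker_mx P) f0 = f0 := (psiP P).2.
Let psi_inj : injective (@ker_mx Fs (iota k)) := @ker_mx_inj _ _ k2 k3.

Lemma unitmx_det1 (R : comUnitRingType) n (g : 'M[R]_n) : \det g = 1 -> g \in unitmx.
Proof. by move=> g1; rewrite unitmxE g1 unitr1. Qed.

(** Galois equivariance: the entries are polynomials in [y] with coefficients in [F]. *)
Lemma map_ker_mx s P : map_mx s (ker_mx P) = ker_mx (gal_ker s P).
Proof.
rewrite /ker_mx /=; have [->|[y -> _]] := kerphi_cases P; first exact: map_mx1.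
by rewrite /= map_mx2 !(rmorphN, fmorphV, rmorphM, rmorph_nat, gal_fix).
Qed.

Lemma gal_ker0 s : gal_ker s 0 = 0 :> kerphi (iota k).
Proof. by apply: val_inj. Qed.

Lemma gal_kerN s P : gal_ker s (- P) = - gal_ker s P.
Proof. by apply/eqP; rewrite -addr_eq0 -gal_kerD addNr gal_ker0. Qed.

Lemma map_bcf_gal s f : map_bcf s (map_bcf iota f) = map_bcf iota f.
Proof. by case: f => a b c d /=; rewrite !gal_fix. Qed.

Lemma map_gal_mx s n m (A : 'M[F]_(m, n)) : map_mx s (map_mx iota A) = map_mx iota A.
Proof. by apply/matrixP => i j; rewrite !mxE gal_fix. Qed.

Lemma base_form_gal s : map_bcf s f0 = f0.
Proof. by rewrite /= rmorph0 rmorph1 gal_fix. Qed.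

Lemma bcf_descent (f : bcf Fs) : (forall s, map_bcf s f = f) ->
  exists f', f = map_bcf iota f'.
Proof.
case: f => a b c d fix_;
  have desc (x : Fs) : (forall s, s x = x) -> exists y, x = iota y by apply: absGal_fixed.
have [|a' ->] := desc a; first by move=> s; case: (fix_ s).
have [|b' ->] := desc b; first by move=> s; case: (fix_ s).
have [|c' ->] := desc c; first by move=> s; case: (fix_ s).
have [|d' ->] := desc d; first by move=> s; case: (fix_ s).
by exists (Bcf a' b' c' d').
Qed.

Lemma mx_descent m n (A : 'M[Fs]_(m, n)) : (forall s, map_mx s A = A) ->
  exists B, A = map_mx iota B.
Proof.
move=> fixA.
have /choice [B AB] : forall ij, exists y, A ij.1 ij.2 = iota y.
  by move=> ij; apply: (absGal_fixed hFs) => s; rewrite -[in RHS](fixA s) mxE.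
by exists (\matrix_(i, j) B (i, j)); apply/matrixP => i j; rewrite !mxE -AB.
Qed.

(* That is, c s = g^-1 s(g) for some g moving the base form to f. *)
Definition represents c f : Prop :=
  exists g, [/\ \det g = 1, bcf_act g f0 = map_bcf iota f &
    forall s, map_mx s g = g *m ker_mx (c s)].

Lemma form_equiv_base f : disc f = 4 * k ->
  exists2 g, \det g = 1 & bcf_act g f0 = map_bcf iota f.
Proof.
move=> hf; have hf' : disc (map_bcf iota f) = 4 * iota k.
  by rewrite disc_map_bcf hf rmorphM rmorph_nat.
have hf0 : disc (map_bcf iota f) != 0.
  by rewrite hf' mulf_neq0 // (natrM _ 2 2) mulf_neq0.
have [u [v [uv fuv]]] := cubic_zero k3 hf0 hFs.2.
by have [g] := root_base_orbit k2 kk hf' uv fuv; exists g.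
Qed.

Lemma represents_disc c f : represents c f -> disc f = 4 * k.
Proof.
case=> g [g1 gf _]; apply: (fmorph_inj iota); rewrite -disc_map_bcf -gf disc_act g1.
by rewrite rmorphM rmorph_nat /=; ring.
Qed.

(** With s(g) = g C(s) from Hilbert 90, the form g f0 is Galois invariant because C(s) fixes f0, so
    it descends to [F]. *)
Lemma cocycle_represents c : Z1 (@gal_ker F Fs iota k) c -> exists f, represents c f.
Proof.
case=> ccont cM.
have [|s|s t|s|g g1 gs] := @cocycle_trivial_SL2 _ _ _ hFs (fun s => ker_mx (c s)).
- by move=> s; have [X cX] := ccont s; exists X => t /cX ->.
- by apply: unitmx_det1; apply: psi_det.
- by rewrite cM psiD map_ker_mx.
- exact: psi_det.
have /bcf_descent [f gf] : forall s, map_bcf s (bcf_act g f0) = bcf_act g f0.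
  by move=> s; rewrite map_bcf_act base_form_gal gs bcf_actM psi_fix.
by exists f, g.
Qed.

(** Both [g] and s(g) move f0 to the same form over [F], so g^-1 s(g) stabilizes f0 and comes from a
    kernel point. *)
Lemma form_represents f : disc f = 4 * k ->
  exists2 c, Z1 (@gal_ker F Fs iota k) c & represents c f.
Proof.
move=> /form_equiv_base [g g1 gf]; have gu := unitmx_det1 g1.
have /choice [c cP] : forall s, exists P, map_mx s g = g *m ker_mx P.
  move=> s; have [|P hP] := ker_mx_surj k2 k3 kk (g := invmx g *m map_mx s g); last first.
    by exists P; rewrite hP mulKVmx.
  split; first by rewrite /SL2 /= det_mulmx det_inv det_map_mx g1 rmorph1 invr1 mulr1.
  apply: (@etrans _ _ (bcf_act (invmx g) (bcf_act (map_mx s g) f0)));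
    first exact: bcf_actM.
  by rewrite -{1}(base_form_gal s) -map_bcf_act gf map_bcf_gal; apply: bcf_act_inv.
exists c; last by exists g.
split.
  (* Continuity: s(g), hence c(s), is determined by the values of [s] on the four entries of [g]. *)
  move=> s; exists [seq g i j | i <- enum 'I_2, j <- enum 'I_2] => t ts; apply: psi_inj.
  apply: (can_inj (mulKmx gu)); rewrite -!cP; apply/matrixP => i j; rewrite !mxE.
  by apply: ts; apply/allpairsP; exists (i, j); rewrite /= !mem_enum.
move=> s t; apply: psi_inj; apply: (can_inj (mulKmx gu)).
rewrite psiD -cP mulmxA -cP -map_ker_mx -map_mxM -cP.
by apply/matrixP => i j; rewrite !mxE.
Qed.

Lemma represents_orbit c f D : \det D = 1 -> represents c f -> represents c (bcf_act D f).
Proof.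
move=> D1 [g [g1 gf gs]]; exists (map_mx iota D *m g); split.
- by rewrite det_mulmx g1 det_map_mx D1 rmorph1 mulr1.
- by rewrite bcf_actM gf map_bcf_act.
- by move=> s; rewrite map_mxM map_gal_mx gs mulmxA.
Qed.

(** The coboundary is absorbed by replacing g' with g' psi(-m), where psi is [ker_mx]. Both matrices
    then have the same cocycle, so their quotient is Galois invariant and descends to the required
    [D]. *)
Lemma cohomologous_orbit c c' m f f' : represents c f -> represents c' f' ->
  (forall s, c' s = c s + (gal_ker s m - m)) -> exists2 D, \det D = 1 & f' = bcf_act D f.
Proof.
move=> [g [g1 gf gs]] [g' [g'1 gf' gs']] cc'.
have gu := unitmx_det1 g1.
pose E := g' *m ker_mx (- m) *m invmx g.
have Eg : E *m g = g' *m ker_mx (- m) by rewrite mulmxKV.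
have /mx_descent [D ED] : forall s, map_mx s E = E.
  move=> s; apply: (can_inj (mulmxK (_ : map_mx s g \in unitmx))) => /=;
    first by rewrite map_unitmx.
  rewrite -map_mxM Eg map_mxM gs' map_ker_mx gs mulmxA Eg -!mulmxA -!psiD;
    congr (_ *m ker_mx _).
  by rewrite cc' gal_kerN -addrA (addrAC (gal_ker s m)) subrr add0r addrC.
have D1 : \det D = 1.
  apply: (fmorph_inj iota); rewrite -det_map_mx -ED !det_mulmx det_inv g1 g'1.
  by rewrite psi_det rmorph1 invr1 !mulr1.
exists D => //; apply: (@map_bcf_inj _ _ iota);
  rewrite map_bcf_act -ED -gf -bcf_actM Eg bcf_actM.
by rewrite psi_fix gf'.
Qed.

(** Over [Fs], D g and g' move f0 to the same form, so they differ by the matrix of a point P.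
    Applying [s] gives P + c(s) = c'(s) + s(P), and m = - P. *)
Lemma orbit_cohomologous c c' f D : represents c f -> represents c' (bcf_act D f) ->
  \det D = 1 ->
  exists m, forall s, c' s = c s + (gal_ker s m - m).
Proof.
move=> [g [g1 gf gs]] [g' [g'1 gf' gs']] D1.
have gu' := unitmx_det1 g'1.
have [|P hP] := ker_mx_surj k2 k3 kk (g := invmx g' *m (map_mx iota D *m g)).
  split; first by rewrite /SL2 /= !det_mulmx det_inv det_map_mx g1 g'1 D1 rmorph1 invr1 !mulr1.
  apply: (@etrans _ _ (bcf_act (invmx g') (bcf_act (map_mx iota D *m g) f0)));
    first exact: bcf_actM.
  by apply: bcf_act_inv; rewrite // gf' map_bcf_act bcf_actM gf.
have {}hP : map_mx iota D *m g = g' *m ker_mx P by rewrite hP mulKVmx.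
exists (- P) => s.
have : P + c s = c' s + gal_ker s P.
  apply: psi_inj; apply: (can_inj (mulKmx gu')).
  rewrite !psiD mulmxA -hP -mulmxA -gs mulmxA -gs' -map_ker_mx -map_mxM -hP.
  by rewrite map_mxM map_gal_mx.
move=> e; rewrite gal_kerN opprK -[LHS](addrK (gal_ker s P)) -e.
by rewrite [P + _]addrC -addrA [P - _]addrC.
Qed.

(** * The bijection between classes and orbits *)

Let coboundaries := B1 (@gal_ker F Fs iota k).

(** Ranging over all cocycles of the class avoids a choice of representative; [class_orbitE] shows
    that the result is one orbit. *)
Definition class_orbit (X : set (absGal iota -> kerphi (iota k))) : set (bcf F) :=
  [set f | exists2 c, X c & represents c f].

Lemma class_orbitE c f : represents c f ->
  class_orbit [set c \+ b | b in coboundaries] = SL2_orbit f.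
Proof.
move=> cf; apply/seteqP; split=> f' /=.
  move=> [_ [b [m bE] <-] c'f'].
  have [D D1 ->] := cohomologous_orbit (m := m) cf c'f'
    (fun s => congr1 (+%R (c s)) (bE s)).
  by exists D.
move=> [D D1 <-]; exists c; last exact: represents_orbit.
exists (fun=> 0); first by exists 0 => s; rewrite gal_ker0 subr0.
by apply/funext => s /=; rewrite addr0.
Qed.

Lemma coboundary_coset c c' m : (forall s, c' s = gal_ker s m - m) ->
  [set (c \+ c') \+ b | b in coboundaries] = [set c \+ b | b in coboundaries].
Proof.
move=> c'E; apply/seteqP; split=> _ [b [n bE] <-].
  exists (fun s => gal_ker s (m + n) - (m + n)); first by exists (m + n).
  apply/funext => s /=; rewrite c'E bE gal_kerD opprD -[RHS]addrA; congr (_ + _).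
  exact: addrACA.
exists (fun s => gal_ker s (n - m) - (n - m)); first by exists (n - m).
apply/funext => s /=; rewrite c'E bE gal_kerD gal_kerN -addrA; congr (_ + _).
rewrite opprB (_ : _ + (m - n) = gal_ker s n - n - (gal_ker s m - m)).
  by rewrite addrC subrK.
by rewrite opprB addrACA [RHS]addrACA [- n - _]addrC.
Qed.

Lemma class_orbit_bij :
  set_bij (H1 (@gal_ker F Fs iota k)) (SL2_orbits (V_disc (4 * k))) class_orbit.
Proof.
split.
- move=> _ [c hc <-]; have [f cf] := cocycle_represents hc.
  by rewrite (class_orbitE cf); exists f => //; apply: represents_disc cf.
- move=> _ _ /set_mem [c hc <-] /set_mem [c' hc' <-] e.
  have [f cf] := cocycle_represents hc.
  have : class_orbit [set c' \+ b | b in coboundaries] f.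
    by rewrite -e (class_orbitE cf); exists 1%:M; [apply: det1|apply: bcf_act1].
  move=> [_ [b [m bE] <-] c'f].
  (* The form f is represented by both [c] and c' + b, so these are compared with D = 1. *)
  have [|m' m'E] := orbit_cohomologous (D := 1%:M) cf (c' := c' \+ b) _ (det1 _ _).
    by rewrite bcf_act1.
  rewrite -(@coboundary_coset c' b m bE).
  have -> : c' \+ b = c \+ (fun s => gal_ker s m' - m') by apply/funext.
  by rewrite (@coboundary_coset c _ m').
- move=> _ [f hf <-]; have [c hc cf] := form_represents hf.
  by exists [set c \+ b | b in coboundaries]; [exists c|apply: class_orbitE].
Qed.

(** * Rational kernel points and stabilizers over the base field *)

Fact embed_ker_subproof (P : kerphi k) :
  let P' := if ker_point P is Some (x, y) then Some (iota x, iota y) else None in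
  on_curve (- 27 * iota k) P' && (hatphi (iota k) P' == None).
Proof.
have [->|[y -> hy]] := kerphi_cases P => //=.
by rewrite rmorph0 eqxx andbT -rmorphXn hy rmorphM rmorphN rmorph_nat expr0n add0r.
Qed.

Definition embed_ker (P : kerphi k) : kerphi (iota k) := KerPhi (embed_ker_subproof P).

Lemma embed_kerD : {morph embed_ker : P Q / P + Q}.
Proof.
move=> P Q; apply: val_inj => /=.
have [->|[y -> hy]] := kerphi_cases P => //.
have [->|[z -> hz]] := kerphi_cases Q => //.
rewrite !ec_add_x0 !rmorph0 ec_add_x0 -rmorphN (inj_eq (fmorph_inj iota)).
by case: ifP => //= _; rewrite rmorph0 rmorphN.
Qed.

Lemma embed_ker_inj : injective embed_ker.
Proof.
move=> P Q /(congr1 (@ker_point _ _)) /= e; apply: val_inj => /=; move: e.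
have [->|[y -> hy]] := kerphi_cases P; have [->|[z -> hz]] := kerphi_cases Q => //=.
by case=> /fmorph_inj ->.
Qed.

(** Affine kernel points have x = 0, so only [y] has to be descended to [F]. *)
Lemma embed_ker_fixed P : (forall s, gal_ker s P = P) <->
  exists Q : kerphi k, embed_ker Q = P.
Proof.
split=> [fixP|[Q <-] s]; last first.
  by apply: val_inj => /=; case: (ker_point Q) => [[x y]|] //=; rewrite !gal_fix.
have [P0|[y Py hy]] := kerphi_cases P.
  by exists 0; apply: val_inj; rewrite /= P0.
have /(absGal_fixed hFs) [z yz] : forall s, s y = y.
  by move=> s; have /(congr1 (@ker_point _ _)) := fixP s; rewrite /= Py /= => -[].
have hQ : on_curve (- 27 * k) (Some (0, z)) && (hatphi k (Some (0, z)) == None).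
  rewrite /= eqxx andbT expr0n add0r; apply/eqP/(fmorph_inj iota).
  by rewrite rmorphXn -yz hy rmorphM rmorphN rmorph_nat.
by exists (KerPhi hQ); apply: val_inj; rewrite /= Py rmorph0 yz.
Qed.

Lemma stab_iso f : V_disc (4 * k) f -> mx_group_iso (SL2_stab f) (kerphi k).
Proof.
move=> hf; have [c _ [g [g1 gf gs]]] := form_represents hf.
have gu := unitmx_det1 g1.
pose R D (Q : kerphi k) := map_mx iota D *m g = g *m ker_mx (embed_ker Q).
have /choice [h hP] : forall D, exists Q : kerphi k, SL2_stab f D -> R D Q.
  (* Off the stabilizer the condition is vacuous and any value serves. *)
  move=> D; have [[D1 Df]|nD] := pselect (SL2_stab f D); last by exists 0.
  have [|P hP] := ker_mx_surj k2 k3 kk (g := invmx g *m (map_mx iota D *m g)).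
    split; first by rewrite /SL2 /= !det_mulmx det_inv det_map_mx g1 D1 rmorph1 invr1 !mulr1.
    apply: (@etrans _ _ (bcf_act (invmx g) (bcf_act (map_mx iota D *m g) f0)));
      first exact: bcf_actM.
    by apply: bcf_act_inv; rewrite // bcf_actM gf -map_bcf_act Df.
  have {}hP : map_mx iota D *m g = g *m ker_mx P by rewrite hP mulKVmx.
  (* Applying [s] to D g = g psi(P), with psi the map [ker_mx], multiplies both [g] by psi(c(s));
     this factor commutes with psi(P) and cancels, leaving s(P) = P. *)
  have /embed_ker_fixed [Q QP] : forall s, gal_ker s P = P.
    move=> s; apply: psi_inj; apply: (can_inj (mulKmx gu)); rewrite -hP.
    apply: (can_inj (mulmxK (unitmx_det1 (psi_det (c s))))).
    rewrite -mulmxA -psiD addrC psiD mulmxA -gs -map_ker_mx -map_mxM -hP.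
    by rewrite map_mxM map_gal_mx gs mulmxA.
  by exists Q => _; rewrite /R QP.
exists h; split; first split=> //.
- move=> D D' /set_mem /hP hD /set_mem /hP hD' e.
  apply/(map_mx_inj (f := iota))/(can_inj (mulmxK gu)).
  by rewrite hD hD' e.
- move=> Q _; pose E := g *m ker_mx (embed_ker Q) *m invmx g.
  have Eg : E *m g = g *m ker_mx (embed_ker Q) by rewrite mulmxKV.
  have /mx_descent [D ED] : forall s, map_mx s E = E.
    move=> s; apply: (can_inj (mulmxK (_ : map_mx s g \in unitmx))) => /=;
      first by rewrite map_unitmx.
    rewrite -map_mxM Eg map_mxM map_ker_mx gs (embed_ker_fixed _).2; last by exists Q.
    by rewrite mulmxA Eg -!mulmxA -!psiD addrC.
  have DS : SL2_stab f D.
    split.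
      apply: (fmorph_inj iota); rewrite -det_map_mx -ED !det_mulmx det_inv g1.
      by rewrite psi_det rmorph1 invr1 !mulr1.
    apply: (@map_bcf_inj _ _ iota); rewrite map_bcf_act -ED -gf -bcf_actM Eg bcf_actM.
    by rewrite psi_fix.
  exists D => //; apply: embed_ker_inj; apply: psi_inj; apply: (can_inj (mulKmx gu)).
  by rewrite -(hP _ DS) -ED Eg.
move=> D D' hD hD'; apply: embed_ker_inj; apply: psi_inj; apply: (can_inj (mulKmx gu)).
have hDD : SL2_stab f (D *m D').
  split; first by rewrite /SL2 /= det_mulmx hD.1 hD'.1 mulr1.
  by rewrite /= bcf_actM hD'.2 hD.2.
rewrite -hP // embed_kerD psiD mulmxA -hP // -mulmxA -hP // mulmxA.
by rewrite map_mxM.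
Qed.
End Correspondence.

Theorem theorem14 (F : fieldType) (hF2 : 2%N \notin [pchar F])
    (hF3 : 3%N \notin [pchar F]) (k : F) (hk : k != 0)
    (Fs : fieldType) (iota : {rmorphism F -> Fs})
    (hFs : separable_closure iota) :
  (exists h : set (absGal iota -> kerphi (iota k)) -> set (bcf F),
     set_bij (H1 (@gal_ker F Fs iota k)) (SL2_orbits (V_disc (4 * k))) h) /\
  (forall f : bcf F, V_disc (4 * k) f -> mx_group_iso (SL2_stab f) (kerphi k)).
Proof.
have h2 : 2%:R != 0 :> F by rewrite inE /= in hF2.
have h3 : 3%:R != 0 :> F by rewrite inE /= in hF3.
split; first by exists (@class_orbit F Fs iota k); apply: class_orbit_bij.
by move=> f; apply: (stab_iso hFs).
Qed.
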